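(* Let $k\ge 1$ be an integer and $\lambda\in[0,1]$. Define $\beta(k)=\sum_{i=0}^{k-1}\lambda^{-i}$ if $\lambda>0$ and $\beta(k)=\infty$ if $\lambda=0$, and \[ \alpha(k)=\begin{cases}1+2\lambda+2\lambda^2+\dots+2\lambda^{(k-1)/2} & \text{if } k \text{ is odd},\\ 1+2\lambda+2\lambda^2+\dots+2\lambda^{k/2-1}+\lambda^{k/2} & \text{if } k \text{ is even.}\end{cases} \] Then there exists a deterministic learning-augmented memory-constrained online algorithm $\mathcal{A}$ for the $k$-server problem on the line such that for every instance $I$ and every prediction for $I$ with prediction error $\eta$, \[ \mathcal{A}(I)\le \min\left\{\alpha(k)\left(1+\frac{\eta}{\mathrm{OPT}(I)}\right),\ \beta(k)\right\}\cdot \mathrm{OPT}(I)+c, \] where $c\ge 0$ depends only on the initial configuration. In particular, for $\lambda>0$ the algorithm is $\alpha(k)$-consistent and $\beta(k)$-robust.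
   Context: The $k$-server problem on the line: $k$ servers start at given positions on $\mathbb{R}$ (initial configuration $C_0$); requests $r_1,\dots,r_n\in\mathbb{R}$ arrive online one by one, and each must be served (before the next is revealed) by moving at least one server to the requested point; cost is the total distance traveled by all servers. Servers are labeled by position, $s_1\le\dots\le s_k$ (overtakings are uncrossed). $\mathrm{OPT}(I)$ is the minimum cost of serving instance $I$ offline. A prediction for an instance with $n$ requests is a sequence $p_1,\dots,p_n\in\{1,\dots,k\}$; $s_{p_t}$ is the predicted server for request $t$. The algorithm FtP (''follow the predictions'') serves each request $r_t$ by moving server $s_{p_t}$ to it (then relabeling servers by position order); $\mathrm{FtP}(I)$ is its cost, and the prediction error is $\eta=\mathrm{FtP}(I)-\mathrm{OPT}(I)$. A learning-augmented algorithm receives $p_t$ together with $r_t$. It is $\alpha$-consistent if $\mathcal{A}(I)\le\alpha\,\mathrm{OPT}(I)+c$ for every instance and every prediction with $\eta=0$, and $\beta$-robust if $\mathcal{A}(I)\le\beta\,\mathrm{OPT}(I)+c$ for every instance and every prediction, where $c$ depends only on the initial configuration. An algorithm is memory-constrained if its decision on each request depends only on the current server configuration, the current request and the current prediction (not on previous requests); it may move several servers per request; and its memory is erasable: for any set of $k$ distinct points and any starting configuration there is a finite sequence of requests among these $k$ points after which each of these points holds exactly one server (such a sequence is called a force to these points). *)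

(* Defs.v *)
From HB Require Import structures.
From mathcomp Require Import all_boot all_order all_algebra.
From mathcomp Require Import classical_sets reals.
Set Implicit Arguments. Unset Strict Implicit. Unset Printing Implicit Defensive.
Import Order.TTheory GRing.Theory Num.Theory.
Local Open Scope ring_scope.
Local Open Scope classical_set_scope.

Section KServer.
Variable R : realType.

(* A configuration of k servers on the line: the list of their positions,
   labelled by position order s_1 <= ... <= s_k (index 0 is s_1). *)
Definition config_ok (k : nat) (C : seq R) : Prop :=
  size C = k /\ sorted <=%R C.

(* Cost of moving from configuration C to configuration C' (both sorted):
   since overtakings are uncrossed, server i travels from s_i to s'_i. *)
Definition move_cost (C C' : seq R) : R :=
  \sum_(i < size C) `|nth 0 C i - nth 0 C' i|.

Fixpoint sched_cost (C : seq R) (Cs : seq (seq R)) : R :=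
  match Cs with
  | [::] => 0
  | C' :: Cs' => move_cost C C' + sched_cost C' Cs'
  end.

Definition feasible_sched (k : nat) (rs : seq R) (Cs : seq (seq R)) : Prop :=
  size Cs = size rs /\
  (forall t, (t < size rs)%N ->
     config_ok k (nth [::] Cs t) /\ nth 0 rs t \in nth [::] Cs t).

Definition OPT (k : nat) (C0 : seq R) (rs : seq R) : R :=
  inf [set x | exists Cs, feasible_sched k rs Cs /\ x = sched_cost C0 Cs].

(* FtP: serve r_t by moving the predicted server s_{p_t} to r_t, then relabel
   servers by position order. Predictions are 0-based indices in 'I_k. *)
Fixpoint ftp_cost (k : nat) (C : seq R) (rs : seq R) (ps : seq 'I_k) : R :=
  match rs, ps with
  | r :: rs', p :: ps' =>
      `|nth 0 C p - r| + ftp_cost (sort <=%R (set_nth 0 C p r)) rs' ps'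
  | _, _ => 0
  end.

Definition pred_error (k : nat) (C0 rs : seq R) (ps : seq 'I_k) : R :=
  ftp_cost C0 rs ps - OPT k C0 rs.

(* A deterministic memory-constrained learning-augmented algorithm: given the
   current configuration, the current request and the current prediction, it
   returns the next configuration (it may move several servers). *)
Definition mc_alg (k : nat) := seq R -> R -> 'I_k -> seq R.

Fixpoint alg_final (k : nat) (A : mc_alg k) (C : seq R) (rs : seq R)
    (ps : seq 'I_k) : seq R :=
  match rs, ps with
  | r :: rs', p :: ps' => alg_final A (A C r p) rs' ps'
  | _, _ => C
  end.

Fixpoint alg_cost (k : nat) (A : mc_alg k) (C : seq R) (rs : seq R)
    (ps : seq 'I_k) : R :=
  match rs, ps with
  | r :: rs', p :: ps' => move_cost C (A C r p) + alg_cost A (A C r p) rs' ps'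
  | _, _ => 0
  end.

Definition serves (k : nat) (A : mc_alg k) : Prop :=
  forall C r p, config_ok k C -> config_ok k (A C r p) /\ r \in A C r p.

Definition erasable (k : nat) (A : mc_alg k) : Prop :=
  forall X : seq R, size X = k -> uniq X ->
  forall C, config_ok k C ->
  exists (rs : seq R) (ps : seq 'I_k),
    size ps = size rs /\ all (fun r => r \in X) rs /\
    alg_final A C rs ps = sort <=%R X.

Definition memory_constrained (k : nat) (A : mc_alg k) : Prop :=
  serves A /\ erasable A.

Definition alpha_k (lam : R) (k : nat) : R :=
  if odd k then 1 + 2 * \sum_(1 <= i < (k./2).+1) lam ^+ i
  else 1 + 2 * \sum_(1 <= i < k./2) lam ^+ i + lam ^+ (k./2).

(* beta(k), meaningful for lam > 0 (beta(k) = +infinity when lam = 0). *)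
Definition beta_k (lam : R) (k : nat) : R :=
  \sum_(0 <= i < k) (lam ^+ i)^-1.

(* The bound  min{alpha(k)(1 + eta/OPT), beta(k)} * OPT, written without
   division as min{alpha(k)(OPT + eta), beta(k) OPT}; when lam = 0 the beta
   term is +infinity and the min is the alpha term. *)
Definition perf_bound (lam : R) (k : nat) (opt eta : R) : R :=
  if 0 < lam then Num.min (alpha_k lam k * (opt + eta)) (beta_k lam k * opt)
  else alpha_k lam k * (opt + eta).

End KServer.

(* Main.v *)
Require Import Defs.
From HB Require Import structures.
From mathcomp Require Import all_boot all_order all_algebra.
From mathcomp Require Import classical_sets reals.
From mathcomp Require Import ring lra zify.
Import Order.TTheory GRing.Theory Num.Theory.
Local Open Scope ring_scope.
Set Implicit Arguments. Unset Strict Implicit. Unset Printing Implicit Defensive.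

(* The algorithm is Double Coverage with unequal speeds: a request between two
   adjacent servers attracts the one on the side of the predicted server at
   speed 1 and the other one at speed lam, until one of them arrives; a request
   outside the convex hull is served by the closest server.

   Both bounds use a potential of the form
     sum_j w_j |s_j - x_j| - sum_j e_j s_j
   where x is the configuration compared with.  Against OPT, the weights depend
   on the rank: w_j = beta(j+1) + beta(k-j) - 1 and e_j = beta(k-j) - beta(j+1)
   (ranks from 0), and w_j <= beta(k).  Against FtP, w is constantly alpha(k),
   and the move of FtP and a rematching together guarantee that the fast server
   approaches its partner.

   Erasability: requesting the points of the target Y with the predictions that
   cost FtP nothing, started at Y, lowers the FtP potential by the distance
   travelled.  A request either moves servers by at least the separation of Y,
   or covers one more point of Y, or drags one server slightly off its target;
   requesting that target next pushes the defect monotonically towards one end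
   of the line, where it disappears. *)

Ltac norm_lra :=
  repeat match goal with |- context [ `|?x| ] => case: (ger0P x) => ? end; lra.

(** * Configurations and sorted matchings *)

Lemma config_le (R : realType) (k : nat) (C : seq R) (i j : nat) :
  config_ok k C -> (i <= j)%N -> (j < k)%N -> C`_i <= C`_j.
Proof.
move=> [sC C_sorted] ij jk; apply: (sorted_leq_nth le_trans lexx) => //.
- by rewrite inE sC (leq_ltn_trans ij).
- by rewrite inE sC.
Qed.

Lemma sum_set_nth (R : realType) (k : nat) (F : nat -> R -> R) (C : seq R)
    (i : nat) (x : R) : (i < k)%N ->
  \sum_(j < k) F j (set_nth 0 C i x)`_j =
  \sum_(j < k) F j C`_j + (F i x - F i C`_i).
Proof.
move=> ik; rewrite (bigD1 (Ordinal ik)) //= [in RHS](bigD1 (Ordinal ik)) //=.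
rewrite nth_set_nth /= eqxx (eq_bigr (fun j : 'I_k => F j C`_j)); first by ring.
by move=> j; rewrite -val_eqE /= nth_set_nth /= => /negbTE ->.
Qed.

Lemma size_set_nth_in (R : realType) (k : nat) (C : seq R) (i : nat) (x : R) :
  size C = k -> (i < k)%N -> size (set_nth 0 C i x) = k.
Proof. by move=> sC ik; rewrite size_set_nth sC; apply/maxn_idPr. Qed.

Lemma move_cost_ge0 (R : realType) (s t : seq R) : 0 <= move_cost s t.
Proof. by apply: sumr_ge0. Qed.

Lemma move_cost_cons (R : realType) (a b : R) (s t : seq R) :
  move_cost (a :: s) (b :: t) = `|a - b| + move_cost s t.
Proof. by rewrite /move_cost big_ord_recl. Qed.

(** Insertion of [b] moves it past each smaller [c]. Each such exchange uncrosses two matched pairs,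
    which never increases the total distance because [a <= a'] and [c < b]. *)
Lemma move_cost_merge1 (R : realType) (s t : seq R) (b : R) :
  sorted <=%R s -> size s = (size t).+1 ->
  move_cost s (merge <=%R [:: b] t) <= move_cost s (b :: t).
Proof.
elim: t s b => [|c t IH] [|a [|a' s]] b //= /andP[aa' s_sorted] [sz].
have [//|cb] := leP b c.
have := IH (a' :: s) b s_sorted; rewrite /= sz => /(_ erefl).
rewrite !move_cost_cons => le_tail.
have exch : `|a - c| + `|a' - b| <= `|a - b| + `|a' - c| by norm_lra.
by move: le_tail exch => /=; lra.
Qed.

(** Insertion sort, one uncrossing after another: the order-preserving matching is a cheapest one.
    This allows arbitrary matchings [z] in the FtP analysis, sorted only at the end. *)
Lemma move_cost_sort (R : realType) (s z : seq R) :
  sorted <=%R s -> size s = size z ->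
  move_cost s (sort <=%R z) <= move_cost s z.
Proof.
elim: z s => [|b z IH] [|a s] //= s_sorted [sz].
have -> : sort <=%R (b :: z) = merge <=%R [:: b] (sort <=%R z).
  apply: (sorted_eq le_trans le_anti).
  - exact: sort_le_sorted.
  - by apply: merge_sorted; [exact: le_total| |exact: sort_le_sorted].
  - by rewrite perm_sym perm_merge perm_sym perm_sort /= perm_cons perm_sym perm_sort.
apply: (le_trans (move_cost_merge1 _ _ _)) => //; first by rewrite size_sort /= sz.
by rewrite !move_cost_cons lerD2l; apply: IH => //; apply: path_sorted s_sorted.
Qed.

(* When the predicted FtP server jumps to [r], the matching is repaired so that
   [r] is matched to any server [s_l] lying between [s_p] and [r]; the optimal
   matching is only increased by the cost FtP pays. *)
Lemma ftp_rematch (R : realType) (k : nat) (s y : seq R) (p l : nat) (r : R) :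
  size s = k -> size y = k -> (p < k)%N -> (l < k)%N ->
  (s`_p <= s`_l <= r) || (r <= s`_l <= s`_p) ->
  exists z : seq R, [/\ size z = k,
    perm_eq z (set_nth 0 y p r), z`_l = r &
    move_cost s z <= move_cost s y + `|y`_p - r|].
Proof.
(* Server [l] receives [r], and [p] inherits the old partner of [l]. For [l = p] the second update
   overwrites the first. *)
move=> ss sy pk lk between; exists (set_nth 0 (set_nth 0 y p y`_l) l r).
have y'l : (set_nth 0 y p y`_l)`_l = y`_l.
  by rewrite nth_set_nth /=; case: eqP.
have sy' : size (set_nth 0 y p y`_l) = k by apply: size_set_nth_in.
split.
- exact: size_set_nth_in.
- apply/permP => a; rewrite !count_set_nth_ltn ?sy ?sy' //.
  rewrite y'l; have : (a (nth 0%R y p) <= count a y)%N.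
    case: (boolP (a y`_p)) => // ayp; rewrite -has_count.
    by apply/hasP; exists y`_p; rewrite ?mem_nth ?sy.
  by case: (a y`_p) (a y`_l) (a r) => [] [] []; lia.
- by rewrite nth_set_nth /= eqxx.
- rewrite /move_cost ss.
  rewrite (sum_set_nth (fun j t => `|s`_j - t|)) // y'l.
  rewrite (sum_set_nth (fun j t => `|s`_j - t|)) //.
  have key : `|s`_p - y`_l| + `|s`_l - r| <=
      `|s`_p - y`_p| + `|s`_l - y`_l| + `|y`_p - r|.
    by case/orP: between => /andP[? ?]; norm_lra.
  lra.
Qed.

(** * The algorithm *)

(** The pair [m] holds the distances travelled by the left and right neighbours of [r]; the tests
    decide whether the fast one arrives first. For [lam = 0] it always does, so the divisions by
    [lam] are never reached. *)
Definition lambda_dc (R : realType) (lam : R) (k : nat) : mc_alg R k :=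
  fun C r p =>
  let i := count (fun s => s < r) C in
  if r \in C then C
  else if i == 0%N then set_nth 0 C 0 r
  else if i == k then set_nth 0 C k.-1 r
  else
    let a := r - C`_i.-1 in
    let b := C`_i - r in
    let m := if (p < i)%N
             then if lam * a <= b then (a, lam * a) else (b / lam, b)
             else if lam * b <= a then (lam * b, b) else (a, a / lam) in
    set_nth 0 (set_nth 0 C i.-1 (C`_i.-1 + m.1)) i (C`_i - m.2).

(** All that the analysis needs from a move. The speed ratio is a product, which covers [lam = 0]
    and both orders of arrival. In [DcBetween], [i] is the left neighbour, one less than the count
    [i] of the algorithm. *)
Variant dc_step (R : realType) (lam : R) (k : nat) (C : seq R) (r : R) (p : nat)
    (C' : seq R) : Prop :=
| DcStay of r \in C & C' = C
| DcLow of r < C`_0 & C' = set_nth 0 C 0 r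
| DcHigh of C`_k.-1 < r & C' = set_nth 0 C k.-1 r
| DcBetween (i : nat) (a b : R) of
    (i.+1 < k)%N & C`_i < r < C`_i.+1 &
    C' = set_nth 0 (set_nth 0 C i (C`_i + a)) i.+1 (C`_i.+1 - b) &
    [/\ 0 <= a, 0 <= b, C`_i + a <= r & r <= C`_i.+1 - b] &
    C`_i + a = r \/ C`_i.+1 - b = r &
    if (p <= i)%N then b = lam * a else a = lam * b.

Lemma count_lt_sorted (R : realType) (C : seq R) (r : R) (j : nat) :
  sorted <=%R C -> (j < size C)%N -> (C`_j < r) = (j < count (fun s => (s < r)%R) C)%N.
Proof.
elim: C j => [|c C IH] j //= C_sorted.
have none : r <= c -> count (fun s => s < r) C = 0%N.
  move=> rc; apply/eqP; rewrite -[_ == _]negbK -lt0n -has_count -all_predC.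
  apply/allP => x xC /=; rewrite -leNgt; apply: le_trans rc _.
  by have /allP/(_ _ xC) := order_path_min le_trans C_sorted.
case: j => [_|j]; first by case: ltP => [//|/none ->].
rewrite ltnS => jC /=; rewrite (IH _ (path_sorted C_sorted) jC).
by case: ltP => [//|/none ->].
Qed.

Lemma lambda_dcP (R : realType) (lam : R) (k : nat) (C : seq R) (r : R) (p : 'I_k) :
  0 <= lam <= 1 -> config_ok k C -> dc_step lam k C r p (lambda_dc lam C r p).
Proof.
move=> /andP[lam0 lam1] [sC C_sorted]; rewrite /lambda_dc.
set i := count _ C.
have k0 : (0 < k)%N by apply: leq_ltn_trans (ltn_ord p).
have ik : (i <= k)%N by rewrite -sC count_size.
have ltE j : (j < k)%N -> (C`_j < r) = (j < i)%N.
  by rewrite -sC; exact: count_lt_sorted.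
case: ifPn => [rC|rC]; first exact: DcStay.
have neq j : (j < k)%N -> C`_j != r.
  by move=> jk; apply: contra rC => /eqP <-; rewrite mem_nth ?sC.
have gtE j : (j < k)%N -> (r < C`_j) = (i <= j)%N.
  by move=> jk; rewrite leqNgt -(ltE _ jk) -leNgt lt_def neq.
case: eqP => [i0|/eqP i0]; first by apply: DcLow => //; rewrite gtE // i0.
case: eqP => [ik'|/eqP ik']; first by apply: DcHigh => //; rewrite ltE ?ik' ?prednK.
have {ik'}ik : (i < k)%N by rewrite ltn_neqAle ik'.
case: i i0 ik ltE gtE => // i _ ik ltE gtE /=.
have L : C`_i < r by rewrite ltE // ltnW.
have U : r < C`_i.+1 by rewrite gtE.
have LU : C`_i < r < C`_i.+1 by rewrite L U.
(* In the branches where the slow server arrives first, the failed test forces [lam] to be positive,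
   so [divfK] applies. *)
have lam_gt0 c d : 0 < c -> c < lam * d -> 0 < lam.
  by move=> c0; rewrite lt0r lam0 andbT; apply: contraTneq => ->; rewrite mul0r -leNgt ltW.
rewrite ltnS; have [pi|pi] := leqP p i; case: ifPn => cmp /=.
- apply: (DcBetween ik LU erefl); rewrite ?pi //; last by left; ring.
  by split; nra.
- move: cmp; rewrite -ltNge => cmp.
  have {}lam_gt0 : 0 < lam by apply: lam_gt0 cmp; rewrite subr_gt0.
  apply: (DcBetween ik LU erefl); rewrite ?pi //.
  + by split; rewrite ?divr_ge0 ?subr_ge0 ?(ltW U) //; last lra;
      rewrite -lerBrDl ler_pdivrMr // mulrC ltW.
  + by right; ring.
  + by rewrite mulrC divfK // gt_eqF.
- apply: (DcBetween ik LU erefl); rewrite ?(leqNgt p) ?pi //=; last by right; ring.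
  by split; nra.
- move: cmp; rewrite -ltNge => cmp.
  have {}lam_gt0 : 0 < lam by apply: lam_gt0 cmp; rewrite subr_gt0.
  apply: (DcBetween ik LU erefl); rewrite ?(leqNgt p) ?pi //=.
  + by split; rewrite ?divr_ge0 ?subr_ge0 ?(ltW L) //; first lra;
      rewrite lerBrDl -lerBrDr ler_pdivrMr // mulrC ltW.
  + by left; ring.
  + by rewrite mulrC divfK // gt_eqF.
Qed.

Lemma dc_step_serves (R : realType) (lam : R) (k : nat) (C : seq R) (r : R)
    (p : nat) (C' : seq R) :
  (0 < k)%N -> config_ok k C -> dc_step lam k C r p C' ->
  config_ok k C' /\ r \in C'.
Proof.
move=> k0 Cok; have [sC _] := Cok.
have le1 j : (j.+1 < k)%N -> C`_j <= C`_j.+1 by move=> jk; apply: config_le Cok _ _.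
case=> [rC ->|r0 ->|rk ->|i a b ik /andP[L U] -> [a0 b0 La Ub] hit _].
- by [].
- have sC' : size (set_nth 0 C 0 r) = k by apply: size_set_nth_in.
  split; last by apply/(nthP 0); exists 0%N; rewrite ?sC' // nth_set_nth.
  split=> //; apply/(sortedP 0) => j; rewrite sC' => jk.
  rewrite !nth_set_nth /=; case: eqP => [j0|_]; last exact: le1.
  by have := le1 _ jk; rewrite j0; lra.
- have k1 : (k.-1 < k)%N by rewrite prednK.
  have sC' : size (set_nth 0 C k.-1 r) = k by apply: size_set_nth_in.
  split; last by apply/(nthP 0); exists k.-1; rewrite ?sC' // nth_set_nth /= eqxx.
  split=> //; apply/(sortedP 0) => j; rewrite sC' => jk; rewrite !nth_set_nth /=.
  case: eqP => [|_]; first lia.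
  by case: eqP => [jE|_]; [have := le1 _ jk; rewrite jE; lra | exact: le1].
- have ik' := ltnW ik.
  have sC' : size (set_nth 0 (set_nth 0 C i (C`_i + a)) i.+1 (C`_i.+1 - b)) = k.
    by apply: size_set_nth_in => //; apply: size_set_nth_in.
  split; last first.
    case: hit => hit; apply/(nthP 0).
    - by exists i; rewrite ?sC' // nth_set_nth /= ltn_eqF // nth_set_nth /= eqxx.
    - by exists i.+1; rewrite ?sC' // nth_set_nth /= eqxx.
  split=> //; apply/(sortedP 0) => j; rewrite sC' => jk.
  rewrite !nth_set_nth /= !nth_set_nth /=; have := le1 _ jk.
  case: (eqVneq j i.+1) => [->|j1]; [|case: (eqVneq j i) => [->|j2]].
  - by rewrite ?eqxx ?gtn_eqF //; lra.
  - by rewrite ?eqxx; lra.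
  - by rewrite ?eqSS ?(negbTE j2); case: eqP => [<-|//]; lra.
Qed.

(** * Comparison with FtP *)

(** The conditions under which a move is paid by the potential: the first two treat requests left
    and right of the hull, the pair treats a gap whose right, respectively left, server is fast. The
    last one keeps the potential nonnegative. *)
Definition ftp_weights (R : realType) (k : nat) (lam al : R) (d : nat -> R) :=
  [/\ d 0%N <= al - 1, 1 - al <= d k.-1,
      forall j, (j.+1 < k)%N ->
        1 + lam - al * (1 - lam) <= lam * d j - d j.+1 /\
        1 + lam - al * (1 - lam) <= d j - lam * d j.+1 &
      forall s : nat -> R, (forall i j, (i <= j)%N -> (j < k)%N -> s i <= s j) ->
        \sum_(j < k) d j * s j <= 0].

Definition ftp_potential (R : realType) (k : nat) (al : R) (d : nat -> R)
    (s y : seq R) : R :=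
  al * move_cost s y - \sum_(j < k) d j * s`_j.

Lemma ftp_potential_ge0 (R : realType) (k : nat) (lam al : R) (d : nat -> R)
    (s y : seq R) :
  0 <= al -> ftp_weights k lam al d -> config_ok k s -> 0 <= ftp_potential k al d s y.
Proof.
move=> al0 [_ _ _ dS] sok; rewrite subr_ge0; apply: (@le_trans _ _ 0).
  by apply: dS => i j ij jk; apply: config_le sok ij jk.
by rewrite mulr_ge0 // move_cost_ge0.
Qed.

Lemma norm_shift (R : realType) (x a z : R) : `|x + a - z| <= `|x - z| + `|a|.
Proof. by rewrite addrAC ler_normD. Qed.

(** The jump of FtP costs at most [al] times its length in the matching term. After rematching, the
    extreme or fast server has partner [r] and approaches it, while the slow one strays by at most
    its own travel. *)
Lemma ftp_potential_step (R : realType) (k : nat) (lam al : R) (d : nat -> R)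
    (C C' y : seq R) (r : R) (p : nat) :
  0 <= al -> ftp_weights k lam al d ->
  config_ok k C -> size y = k -> (p < k)%N -> dc_step lam k C r p C' ->
  move_cost C C' + ftp_potential k al d C' (sort <=%R (set_nth 0 y p r))
  <= ftp_potential k al d C y + al * `|y`_p - r|.
Proof.
move=> al0 [d0 dk dd _] Cok sy pk step.
have k0 : (0 < k)%N by apply: leq_ltn_trans pk.
have [[sC' C'_sorted] _] := dc_step_serves k0 Cok step.
have [sC _] := Cok.
have match_ l : (l < k)%N -> (C`_p <= C`_l <= r) || (r <= C`_l <= C`_p) ->
    exists z, [/\ z`_l = r, move_cost C' (sort <=%R (set_nth 0 y p r)) <= move_cost C' z &
      move_cost C z <= move_cost C y + `|y`_p - r|].
  move=> lk /(ftp_rematch sC sy pk lk)[z [sz zy zl le_z]]; exists z; split=> //.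
  by rewrite -(perm_sort_leP _ _ zy) move_cost_sort // sC' sz.
have Cle i j : (i <= j)%N -> (j < k)%N -> C`_i <= C`_j := config_le Cok.
(* The matching [z] stays fixed while the algorithm moves; [dM] bounds the resulting change of its
   cost, and sorting comes last. *)
suff [z [dM [leM lez ledM]]] : exists z dM,
    [/\ move_cost C' (sort <=%R (set_nth 0 y p r)) <= move_cost C z + dM,
        move_cost C z <= move_cost C y + `|y`_p - r| &
        move_cost C C' + al * dM - \sum_(j < k) d j * C'`_j <= - \sum_(j < k) d j * C`_j].
  have := ler_wpM2l al0 leM; have := ler_wpM2l al0 lez.
  by rewrite /ftp_potential !mulrDr; lra.
case: step => [rC C'E|r0 C'E|rk C'E|i a b ik /andP[L U] C'E [a0 b0 La Ub] hit speed].
- have [l lk rl] := nthP 0 rC; rewrite sC in lk.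
  have [|z [_ zs zC]] := match_ l lk.
    by rewrite rl lexx andbT /=; case: leP => //= /ltW.
  exists z, 0; rewrite addr0 mulr0 addr0 C'E; split=> //; first by rewrite -C'E.
  by rewrite /move_cost big1 ?add0r // => j _; rewrite subrr normr0.
- have [|z [zl zs zC]] := match_ 0%N k0; first by apply/orP; right; rewrite (ltW r0) Cle.
  exists z, (r - C`_0); split=> //.
    apply: (le_trans zs); rewrite /move_cost sC' sC C'E.
    by rewrite (sum_set_nth (fun j t => `|t - z`_j|)) // zl; norm_lra.
  rewrite C'E (sum_set_nth (fun j t => d j * t)) // /move_cost sC.
  rewrite (sum_set_nth (fun j t => `|C`_j - t|)) // big1 => [|j _]; last by rewrite subrr normr0.
  by rewrite subrr normr0 gtr0_norm ?subr_gt0 //; nra.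
- have k1 : (k.-1 < k)%N by rewrite prednK.
  have [|z [zl zs zC]] := match_ k.-1 k1; first by apply/orP; left; rewrite (ltW rk) Cle // -ltnS prednK.
  exists z, (C`_k.-1 - r); split=> //.
    apply: (le_trans zs); rewrite /move_cost sC' sC C'E.
    by rewrite (sum_set_nth (fun j t => `|t - z`_j|)) // zl; norm_lra.
  rewrite C'E (sum_set_nth (fun j t => d j * t)) // /move_cost sC.
  rewrite (sum_set_nth (fun j t => `|C`_j - t|)) // big1 => [|j _]; last by rewrite subrr normr0.
  by rewrite subrr normr0 ltr0_norm ?subr_lt0 //; nra.
have ik' := ltnW ik.
have nthi1 : (set_nth 0 C i (C`_i + a))`_i.+1 = C`_i.+1.
  by rewrite nth_set_nth /= gtn_eqF.
have [dd1 dd2] := dd _ ik.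
have sumE : \sum_(j < k) d j * C'`_j =
    \sum_(j < k) d j * C`_j + d i * a - d i.+1 * b.
  rewrite C'E (sum_set_nth (fun j t => d j * t)) // nthi1.
  by rewrite (sum_set_nth (fun j t => d j * t)) //; ring.
have costE : move_cost C C' = a + b.
  rewrite C'E /move_cost sC (sum_set_nth (fun j t => `|C`_j - t|)) // nthi1.
  rewrite (sum_set_nth (fun j t => `|C`_j - t|)) // big1 => [|j _]; last by rewrite subrr normr0.
  have -> : C`_i - (C`_i + a) = - a by ring.
  have -> : C`_i.+1 - (C`_i.+1 - b) = b by ring.
  by rewrite !subrr normr0 normrN !ger0_norm // add0r !subr0.
have matchE z : move_cost C' z = move_cost C z + (`|C`_i + a - z`_i| - `|C`_i - z`_i|)
    + (`|C`_i.+1 - b - z`_i.+1| - `|C`_i.+1 - z`_i.+1|).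
  rewrite /move_cost sC' sC C'E (sum_set_nth (fun j t => `|t - z`_j|)) // nthi1.
  by rewrite (sum_set_nth (fun j t => `|t - z`_j|)).
(* The fast neighbour lies between the predicted server and [r], so it may be the one rematched to
   [r]. The change [dM] is then slow minus fast distance. *)
move: speed; case: leqP => pi speed.
- have [|z [zl zs zC]] := match_ i ik'; first by apply/orP; left; rewrite (ltW L) Cle.
  exists z, (b - a); split=> //; last by rewrite costE sumE speed; nra.
  apply: (le_trans zs); rewrite matchE zl (ler0_norm (x := _ + a - r)) ?subr_le0 //.
  rewrite (ltr0_norm (x := C`_i - r)) ?subr_lt0 //.
  by have := norm_shift C`_i.+1 (- b) z`_i.+1; rewrite normrN (ger0_norm b0); lra.
- have [|z [zl zs zC]] := match_ i.+1 ik; first by apply/orP; right; rewrite (ltW U) Cle.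
  exists z, (a - b); split=> //; last by rewrite costE sumE speed; nra.
  apply: (le_trans zs); rewrite matchE zl (ger0_norm (x := _ - b - r)) ?subr_ge0 //.
  rewrite (gtr0_norm (x := C`_i.+1 - r)) ?subr_gt0 //.
  by have := norm_shift C`_i a z`_i; rewrite (ger0_norm a0); lra.
Qed.

(** * The recursion for [alpha_k] and the drift coefficients against FtP *)

Lemma geometric_shift (R : realType) (lam : R) (m : nat) :
  \sum_(1 <= i < m.+2) lam ^+ i = lam + lam * \sum_(1 <= i < m.+1) lam ^+ i.
Proof.
rewrite big_ltn // expr1 big_add1 /= mulr_sumr; congr (_ + _).
by apply: eq_bigr => i _; rewrite exprS.
Qed.

(** One recursion serves both parities. At [n = 0] the closed formula gives [2] and the recursion
    fails in general, so inductions start from one and two servers. *)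
Lemma alpha_kSS (R : realType) (lam : R) (n : nat) : (0 < n)%N ->
  alpha_k lam n.+2 = 1 + lam + lam * alpha_k lam n.
Proof.
move=> n0; rewrite /alpha_k /= negbK; case: ifPn => odd_n.
  by rewrite geometric_shift; ring.
have : (0 < n./2)%N by rewrite half_gt0; case: n n0 odd_n => [|[|n]].
by case: (n./2) => // h _; rewrite geometric_shift exprS; ring.
Qed.

Lemma alpha_k1 (R : realType) (lam : R) : alpha_k lam 1 = 1.
Proof. by rewrite /alpha_k /= big_geq // mulr0 addr0. Qed.

Lemma alpha_k2 (R : realType) (lam : R) : alpha_k lam 2 = 1 + lam.
Proof. by rewrite /alpha_k /= big_geq // mulr0 addr0 expr1. Qed.

Lemma alpha_k_ge1 (R : realType) (lam : R) (n : nat) :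
  0 <= lam -> (0 < n)%N -> 1 <= alpha_k lam n.
Proof.
move=> lam0; elim/ltn_ind: n => -[|[|[|n]]] // IH _.
- by rewrite alpha_k1.
- by rewrite alpha_k2; lra.
- by rewrite alpha_kSS //; have := IH n.+1 (ltnW (ltnSn _)) isT; nra.
Qed.

(* Peeling off the two outermost servers: the weights of [k] servers are those
   of [k - 2] servers scaled by [lam], surrounded by [+-(alpha(k) - 1)]. *)
Lemma ftp_weights_exist (R : realType) (lam : R) (k : nat) :
  0 <= lam <= 1 -> (0 < k)%N ->
  exists d : nat -> R, [/\ ftp_weights k lam (alpha_k lam k) d,
    d 0%N = alpha_k lam k - 1 & d k.-1 = 1 - alpha_k lam k].
Proof.
move=> /andP[lam0 lam1]; elim/ltn_ind: k => -[|[|[|n]]] // IH _.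
- exists (fun=> 0); rewrite alpha_k1; split; rewrite ?subrr //.
  split; rewrite ?subrr // => s _.
  by rewrite big_ord_recl big_ord0 mul0r addr0.
- exists (fun j => if j == 0%N then lam else - lam).
  rewrite alpha_k2 /=; split; [split|ring|ring].
  + by rewrite /=; lra.
  + by rewrite /=; lra.
  + by case=> // _ /=; split; nra.
  + move=> s s_mono; rewrite big_ord_recl big_ord_recl big_ord0 /= /bump /= addr0.
    by have := s_mono 0%N 1%N isT isT; nra.
have [d [[_ _ dd dS] d0 dn]] := IH n.+1 (ltnW (ltnSn _)) isT.
have a1 := @alpha_k_ge1 R lam n.+1 lam0 isT.
move: dd d0 dn; rewrite (@alpha_kSS R lam n.+1) //=; set a := alpha_k lam n.+1 in a1 *.
move=> dd d0 dn.
(* Where outer and inner coefficients meet, one of the two inequalities is an equality and the other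
   has room [2 * lam * (1 - lam) * a]. *)
have slack : 0 <= lam * (1 - lam) * a by rewrite !mulr_ge0 ?subr_ge0 //; lra.
exists (fun j => if j == 0%N then lam + lam * a
                 else if j == n.+2 then - (lam + lam * a) else lam * d j.-1).
split; [split|by rewrite /=; ring|by rewrite /= eqxx; ring].
- by rewrite /=; lra.
- by rewrite /= eqxx; lra.
- case=> [|j]; rewrite !ltnS => jn /=.
  + by rewrite d0; split; lra.
  + rewrite !eqSS (ltn_eqF (jn : j < n.+1)%N); case: eqP => [->|/eqP jn'].
    * by rewrite dn; split; lra.
    (* The threshold [1 + lam - al * (1 - lam)] for the larger system is exactly [lam] times the one
       for the inner system, so scaling preserves the inequalities. *)
    * have [|dd1 dd2] := dd j; first by rewrite ltn_neqAle jn'.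
      have := ler_wpM2l lam0 dd1; have := ler_wpM2l lam0 dd2.
      by split; lra.
- move=> s s_mono; rewrite big_ord_recl big_ord_recr /= /bump /= add1n eqxx.
  rewrite (eq_bigr (fun j : 'I_n.+1 => lam * (d j * s j.+1))); last first.
    by move=> j _; rewrite /= /bump /= add1n eqSS (ltn_eqF (ltn_ord j)) /= mulrA.
  rewrite -mulr_sumr.
  have c0 : 0 <= lam + lam * a by nra.
  have /(ler_wpM2l lam0) := dS (fun j => s j.+1) (fun i j ij jn => s_mono i.+1 j.+1 ij (leqW jn)).
  have /(ler_wpM2l c0) := s_mono 0%N n.+2 isT (ltnSn _).
  by rewrite mulr0; lra.
Qed.

Lemma alg_cost_le_ftp (R : realType) (k : nat) (lam al : R) (d : nat -> R)
    (C y rs : seq R) (ps : seq 'I_k) :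
  0 <= lam <= 1 -> 0 <= al -> ftp_weights k lam al d -> config_ok k C -> size y = k ->
  alg_cost (lambda_dc lam (k := k)) C rs ps
  <= al * ftp_cost y rs ps + ftp_potential k al d C y.
Proof.
move=> lam01 al0 dW; elim: rs ps C y => [|r rs IH] [|p ps] C y Cok sy /=;
  rewrite ?mulr0 ?add0r ?(ftp_potential_ge0 _ al0 dW) //.
have step := lambda_dcP r p lam01 Cok.
have k0 : (0 < k)%N by apply: leq_ltn_trans (ltn_ord p).
have [C'ok _] := dc_step_serves k0 Cok step.
have sy' : size (sort <=%R (set_nth 0 y p r)) = k.
  by rewrite size_sort; apply: size_set_nth_in.
have := IH ps _ _ C'ok sy'.
have := ftp_potential_step al0 dW Cok sy (ltn_ord p) step.
by rewrite mulrDr; lra.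
Qed.

(** * Comparison with OPT *)

Lemma beta_kS (R : realType) (lam : R) (n : nat) :
  beta_k lam n.+1 = beta_k lam n + (lam ^+ n)^-1.
Proof. by rewrite /beta_k big_nat_recr. Qed.

Lemma mul_beta_kS (R : realType) (lam : R) (n : nat) : lam != 0 ->
  lam * (beta_k lam n.+1 - 1) = beta_k lam n.
Proof.
move=> lam0; rewrite /beta_k big_nat_recl // expr0 invr1 addrC addrA addNr add0r mulr_sumr.
by apply: eq_bigr => i _; rewrite exprS invfM mulrA divff // mul1r.
Qed.

Lemma beta_k_homo (R : realType) (lam : R) : 0 < lam ->
  {homo beta_k lam : m n / (m <= n)%N >-> m <= n}.
Proof.
move=> lam0; apply: homo_leq => [//||n]; first exact: le_trans.
by rewrite beta_kS lerDl invr_ge0 exprn_ge0 // ltW.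
Qed.

(** Apart from its first term [1], the second sum has [c] terms; moving them to the later indices
    [a, ..., a + c - 1] cannot decrease them, since [lam <= 1]. *)
Lemma beta_k_add (R : realType) (lam : R) (a c : nat) : 0 < lam <= 1 -> (0 < a)%N ->
  beta_k lam a + beta_k lam c.+1 <= beta_k lam (a + c) + 1.
Proof.
move=> /andP[lam0 lam1] a0; elim: c => [|c IH].
  by rewrite addn0 /beta_k big_nat1 expr0 invr1.
rewrite addnS (beta_kS _ c.+1) (beta_kS _ (a + c)).
have : (lam ^+ c.+1)^-1 <= (lam ^+ (a + c))^-1.
  rewrite lef_pV2 ?posrE ?exprn_gt0 //; apply: ler_wiXn2l => //; first exact: ltW.
  exact: leq_add a0 (leqnn c).
by lra.
Qed.

Definition opt_pull (R : realType) (lam : R) (k j : nat) : R :=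
  beta_k lam j.+1 + beta_k lam (k - j) - 1.

Definition opt_drift (R : realType) (lam : R) (k j : nat) : R :=
  beta_k lam (k - j) - beta_k lam j.+1.

(* The sum of the two weights of server [j] is [2 beta(k - j) - 1] and their
   difference is [2 beta(j + 1) - 1], and [lam (2 beta(n + 1) - 2) = 2 beta(n)]:
   this is what makes the potential drop when a server moves in the wrong
   direction while its neighbour moves at relative speed [lam]. *)
Definition opt_potential (R : realType) (lam : R) (k : nat) (s x : seq R) : R :=
  \sum_(j < k) opt_pull lam k j * `|s`_j - x`_j| -
  \sum_(j < k) opt_drift lam k j * s`_j.

Lemma opt_pull_ge0 (R : realType) (lam : R) (k j : nat) :
  0 < lam <= 1 -> (j < k)%N -> 0 <= opt_pull lam k j.
Proof.
move=> /andP[lam0 lam1] jk; rewrite /opt_pull.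
have := @beta_k_homo R lam lam0 1%N j.+1 isT.
have := @beta_k_homo R lam lam0 1%N (k - j)%N; rewrite subn_gt0 => /(_ jk).
by rewrite /beta_k big_nat1 expr0 invr1; lra.
Qed.

(** Source of the robustness ratio: an offline server raises the potential by at most its pull per
    unit of distance. *)
Lemma opt_pull_le (R : realType) (lam : R) (k j : nat) :
  0 < lam <= 1 -> (j < k)%N -> opt_pull lam k j <= beta_k lam k.
Proof.
move=> lam01 jk; rewrite /opt_pull.
have := @beta_k_add R lam j.+1 (k - j.+1) lam01 isT.
by rewrite subnKC // -subSn // subSS; lra.
Qed.

(** Reversing the ranks negates the drift. Averaging the sum with its reversal therefore leaves
    products of a drift and a position difference of opposite signs. *)
Lemma sum_opt_drift_le0 (R : realType) (lam : R) (k : nat) (s : seq R) :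
  0 < lam -> config_ok k s -> \sum_(j < k) opt_drift lam k j * s`_j <= 0.
Proof.
move=> lam0 sok; set S := \sum_(j < k) _.
have S2 : S + S = \sum_(j < k) opt_drift lam k j * (s`_j - s`_(rev_ord j)).
  rewrite {2}/S (reindex_inj rev_ord_inj) /= -big_split /=; apply: eq_bigr => j _.
  rewrite /opt_drift subKn // subnSK //; ring.
suff : S + S <= 0 by lra.
rewrite S2; apply: sumr_le0 => j _; rewrite /opt_drift /=.
have jk := ltn_ord j.
have [le_j|lt_j] := leqP j.+1 (k - j).
- have := beta_k_homo lam0 le_j.
  have : s`_j <= s`_(k - j.+1) by apply: (config_le sok); lia.
  by nra.
- have := beta_k_homo lam0 (ltnW lt_j).
  have : s`_(k - j.+1) <= s`_j by apply: (config_le sok); lia.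
  by nra.
Qed.

Lemma opt_potential_ge0 (R : realType) (lam : R) (k : nat) (s x : seq R) :
  0 < lam <= 1 -> config_ok k s -> 0 <= opt_potential lam k s x.
Proof.
move=> lam01 sok; have /andP[lam0 _] := lam01.
rewrite subr_ge0; apply: (le_trans (sum_opt_drift_le0 lam0 sok)).
by apply: sumr_ge0 => j _; rewrite mulr_ge0 // opt_pull_ge0.
Qed.

Lemma opt_potential_move (R : realType) (lam : R) (k : nat) (s x x' : seq R) :
  0 < lam <= 1 -> size x = k ->
  opt_potential lam k s x' <= opt_potential lam k s x + beta_k lam k * move_cost x x'.
Proof.
move=> lam01 sx; rewrite /opt_potential /move_cost sx [leRHS]addrAC lerD2r.
rewrite mulr_sumr -big_split /=; apply: ler_sum => j _.
have w0 := opt_pull_ge0 lam01 (ltn_ord j).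
have w1 := opt_pull_le lam01 (ltn_ord j).
have tri : `|s`_j - x'`_j| <= `|s`_j - x`_j| + `|x`_j - x'`_j|.
  exact: ler_distD.
apply: (le_trans (ler_wpM2l w0 tri)); rewrite mulrDr lerD2l.
exact: ler_wpM2r.
Qed.

(** Since [x] already covers [r], at least one neighbour of [r] (or the extreme server) moves
    towards its partner. Its gain pays for both moves and for the other server, which may move
    away. *)
Lemma opt_potential_step (R : realType) (lam : R) (k : nat) (C C' x : seq R)
    (r : R) (p : nat) :
  0 < lam <= 1 -> (0 < k)%N -> config_ok k C -> config_ok k x -> r \in x ->
  dc_step lam k C r p C' ->
  move_cost C C' + opt_potential lam k C' x <= opt_potential lam k C x.
Proof.
move=> lam01 k0 Cok xok rx step; have /andP[lam0 lam1] := lam01.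
have [sC _] := Cok; have [sx _] := xok.
have [l lk xl] := nthP 0 rx; rewrite sx in lk.
have xle i j : (i <= j)%N -> (j < k)%N -> x`_i <= x`_j := config_le xok.
pose F j t := opt_pull lam k j * `|t - x`_j|; pose G j t := opt_drift lam k j * t.
have beta1 : beta_k lam 1 = 1 by rewrite /beta_k big_nat1 expr0 invr1.
rewrite /opt_potential -/(F _ _) -/(G _ _).
case: step => [rC ->|r0 ->|rk ->|i a b ik /andP[L U] -> [a0 b0 La Ub] hit speed].
- rewrite /move_cost big1 ?add0r // => j _; first by rewrite subrr normr0.
- rewrite (sum_set_nth F) // (sum_set_nth G) // /move_cost sC.
  rewrite (sum_set_nth (fun j t => `|C`_j - t|)) // big1 => [|j _]; last by rewrite subrr normr0.
  have x0 : x`_0 <= r by rewrite -xl xle.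
  rewrite /F /G /opt_pull /opt_drift subn0 beta1 subrr normr0.
  rewrite gtr0_norm ?subr_gt0 // ger0_norm ?subr_ge0 // ger0_norm; last by lra.
  lra.
- have k1 : (k.-1 < k)%N by rewrite prednK.
  rewrite (sum_set_nth F) // (sum_set_nth G) // /move_cost sC.
  rewrite (sum_set_nth (fun j t => `|C`_j - t|)) // big1 => [|j _]; last by rewrite subrr normr0.
  have x0 : r <= x`_k.-1 by rewrite -xl xle // -ltnS prednK.
  have kk : (k - k.-1 = 1)%N by lia.
  rewrite /F /G /opt_pull /opt_drift kk beta1 prednK // subrr normr0.
  rewrite ltr0_norm ?subr_lt0 // ler0_norm ?subr_le0 // ler0_norm; last by lra.
  lra.
have ik' := ltnW ik.
have nthi1 : (set_nth 0 C i (C`_i + a))`_i.+1 = C`_i.+1.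
  by rewrite nth_set_nth /= gtn_eqF.
have costE : move_cost C (set_nth 0 (set_nth 0 C i (C`_i + a)) i.+1 (C`_i.+1 - b)) = a + b.
  rewrite /move_cost sC (sum_set_nth (fun j t => `|C`_j - t|)) // nthi1.
  rewrite (sum_set_nth (fun j t => `|C`_j - t|)) // big1 => [|j _]; last by rewrite subrr normr0.
  have -> : C`_i - (C`_i + a) = - a by ring.
  have -> : C`_i.+1 - (C`_i.+1 - b) = b by ring.
  by rewrite !subrr normr0 normrN !ger0_norm // add0r !subr0.
rewrite costE (sum_set_nth F) // nthi1 (sum_set_nth F) //.
rewrite (sum_set_nth G) // nthi1 (sum_set_nth G) //.
have sq t : 0 <= t -> lam * (lam * t) <= t.
  by move=> t0; rewrite mulrA ler_piMl // mulr_ile1 // ltW.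
(* Whichever server is fast, both inequalities hold. Nothing else about the speeds is used, hence
   the bound is independent of the prediction. *)
have [ab ba] : lam * a <= b /\ lam * b <= a.
  by move: speed; case: ifP => _ ->; split; rewrite ?sq.
have w0 := opt_pull_ge0 lam01 ik'; have w1 := opt_pull_ge0 lam01 ik.
suff : a + b + opt_pull lam k i * (`|C`_i + a - x`_i| - `|C`_i - x`_i|) +
    opt_pull lam k i.+1 * (`|C`_i.+1 - b - x`_i.+1| - `|C`_i.+1 - x`_i.+1|)
    <= opt_drift lam k i * a - opt_drift lam k i.+1 * b.
  by rewrite /F /G; lra.
have [li|il] := leqP l i.
- have xi : r <= x`_i by rewrite -xl xle.
  rewrite (ler0_norm (x := _ + a - _)); last by lra.
  rewrite (ler0_norm (x := C`_i - _)); last by lra.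
  have /(ler_wpM2l w1) := norm_shift C`_i.+1 (- b) x`_i.+1.
  rewrite normrN (ger0_norm b0) => w1b.
  suff : (a + b) - opt_pull lam k i * a + opt_pull lam k i.+1 * b
    <= opt_drift lam k i * a - opt_drift lam k i.+1 * b by lra.
  (* The goal amounts to [beta(k-i-1) * b <= (beta(k-i) - 1) * a]; its left factor is
     [lam * (beta(k-i) - 1)], so [lam * b <= a] suffices. *)
  rewrite /opt_pull /opt_drift -(subnSK ik').
  have rec := mul_beta_kS (k - i.+1) (lt0r_neq0 lam0).
  have : (beta_k lam (k - i.+1).+1 - 1) * (lam * b) <= (beta_k lam (k - i.+1).+1 - 1) * a.
    apply: ler_wpM2l => //; rewrite subr_ge0 -beta1; exact: beta_k_homo.
  by rewrite mulrA (mulrC _ lam) rec; lra.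
- have xi : x`_i.+1 <= r by rewrite -xl xle.
  rewrite (ger0_norm (x := _ - b - _)); last by lra.
  rewrite (ger0_norm (x := C`_i.+1 - _)); last by lra.
  have /(ler_wpM2l w0) := norm_shift C`_i a x`_i.
  rewrite (ger0_norm a0) => w0a.
  suff : (a + b) + opt_pull lam k i * a - opt_pull lam k i.+1 * b
    <= opt_drift lam k i * a - opt_drift lam k i.+1 * b by lra.
  rewrite /opt_pull /opt_drift.
  have rec := mul_beta_kS i.+1 (lt0r_neq0 lam0).
  have : (beta_k lam i.+2 - 1) * (lam * a) <= (beta_k lam i.+2 - 1) * b.
    apply: ler_wpM2l => //; rewrite subr_ge0 -beta1; exact: beta_k_homo.
  by rewrite mulrA (mulrC _ lam) rec; lra.
Qed.

(** In each round the schedule moves first, so the algorithm's step is compared with a configuration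
    that covers the request. *)
Lemma alg_cost_le_sched (R : realType) (lam : R) (k : nat) (C x rs : seq R)
    (ps : seq 'I_k) (Cs : seq (seq R)) :
  0 < lam <= 1 -> config_ok k C -> config_ok k x -> feasible_sched k rs Cs ->
  alg_cost (lambda_dc lam (k := k)) C rs ps
  <= beta_k lam k * sched_cost x Cs + opt_potential lam k C x.
Proof.
move=> lam01; have /andP[lam0 lam1] := lam01.
have beta0 : 0 <= beta_k lam k.
  by apply: sumr_ge0 => i _; rewrite invr_ge0 exprn_ge0 // ltW.
have sched0 : forall x' Cs', 0 <= sched_cost x' Cs' :> R.
  move=> x' Cs'; elim: Cs' x' => //= x'' Cs' IH x'; exact: addr_ge0 (move_cost_ge0 _ _) (IH _).
elim: rs ps C x Cs => [|r rs IH] [|p ps] C x Cs Cok xok [sCs feas] /=.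
1-3: by rewrite addr_ge0 ?mulr_ge0 ?opt_potential_ge0.
case: Cs sCs feas => [|x' Cs] //= [sCs] feas.
have [x'ok rx'] := feas 0%N isT.
have feas' : feasible_sched k rs Cs by split=> // t; exact: (feas t.+1).
have lam01' : 0 <= lam <= 1 by rewrite lam1 ltW.
have step := lambda_dcP r p lam01' Cok.
have k0 : (0 < k)%N by apply: leq_ltn_trans (ltn_ord p).
have [C'ok _] := dc_step_serves k0 Cok step.
have := IH ps _ _ _ C'ok x'ok feas'.
have := opt_potential_step lam01 k0 Cok x'ok rx' step.
have := opt_potential_move C x' lam01 (proj1 xok).
by rewrite /= mulrDr; lra.
Qed.

Lemma alg_cost_le_OPT (R : realType) (lam : R) (k : nat) (C rs : seq R)
    (ps : seq 'I_k) :
  0 < lam <= 1 -> (0 < k)%N -> config_ok k C ->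
  alg_cost (lambda_dc lam (k := k)) C rs ps
  <= beta_k lam k * OPT k C rs + opt_potential lam k C C.
Proof.
move=> lam01 k0 Cok; have /andP[lam0 lam1] := lam01.
have beta0 : 0 < beta_k lam k.
  apply: lt_le_trans ltr01 _; have := beta_k_homo lam0 k0.
  by rewrite {1}/beta_k big_nat1 expr0 invr1.
rewrite -lerBlDr -ler_pdivrMl //; apply: lb_le_inf.
(* The infimum needs a nonempty set: gathering all [k] servers at each request is feasible. *)
- exists (sched_cost C [seq nseq k r | r <- rs]).
  exists [seq nseq k r | r <- rs]; split=> //; split; first by rewrite size_map.
  move=> t tr; rewrite (nth_map 0) //; split; last by rewrite mem_nseq k0 eqxx.
  split; first by rewrite size_nseq.
  by apply/(sortedP 0) => i; rewrite size_nseq => ik; rewrite !nth_nseq ik ltnW.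
- move=> _ [Cs [feas ->]]; rewrite ler_pdivrMl // lerBlDr.
  exact: alg_cost_le_sched.
Qed.

(** * Erasability *)

Lemma count_sub_in (T : eqType) (Y : seq T) (a b : pred T) :
  (forall y, y \in Y -> a y -> b y) -> (count a Y <= count b Y)%N.
Proof.
move=> ab; rewrite (@eq_in_count _ a (fun y => (y \in Y) && a y)); last by move=> y /= ->.
by apply: sub_count => y /andP[]; apply: ab.
Qed.

(** Only [w] can be lost, and the new element [z] makes up for it. *)
Lemma count_exchange (T : eqType) (Y : seq T) (a b : pred T) (w z : T) :
  uniq Y -> (forall y, y \in Y -> a y -> b y \/ y = w) ->
  z \in Y -> b z -> ~~ a z -> (count a Y <= count b Y)%N.
Proof.
move=> uY ab zY bz az.
have a'z : (count (predD1 a w) Y + 1 <= count b Y)%N.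
  have <- : count (pred1 z) Y = 1%N by rewrite (count_uniq_mem _ uY) zY.
  rewrite -count_predUI.
  have -> : count (predI (predD1 a w) (pred1 z)) Y = 0%N.
    apply/eqP; rewrite -[_ == _]negbK -lt0n -has_count; apply/hasPn => y _ /=.
    by apply/negP => /andP[/andP[_ ay] /eqP yz]; move: az; rewrite -yz ay.
  rewrite addn0; apply: count_sub_in => y yY /= /orP[/andP[yw ay]|/eqP-> //].
  by case: (ab y yY ay) => // yw'; move: yw; rewrite yw' eqxx.
apply: leq_trans a'z; apply: (@leq_trans (count (predU (predD1 a w) (pred1 w)) Y)).
  by apply: sub_count => y ay /=; case: eqP => //=; rewrite ?orbT // ay.
have : (count (pred1 w) Y <= 1)%N by rewrite (count_uniq_mem _ uY) leq_b1.
have := count_predUI (predD1 a w) (pred1 w) Y.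
lia.
Qed.

Lemma count_gain (T : eqType) (Y : seq T) (a b : pred T) (z : T) :
  (forall y, y \in Y -> a y -> b y) ->
  z \in Y -> b z -> ~~ a z -> (count a Y < count b Y)%N.
Proof.
move=> ab zY bz az.
have : (count a Y + count (pred1 z) Y <= count b Y)%N.
  rewrite -count_predUI.
  have -> : count (predI a (pred1 z)) Y = 0%N.
    apply/eqP; rewrite -[_ == _]negbK -lt0n -has_count; apply/hasPn => y _ /=.
    by apply/negP => /andP[ay /eqP yz]; move: az; rewrite -yz ay.
  by rewrite addn0; apply: count_sub_in => y yY /= /orP[/(ab y yY)//|/eqP-> //].
have : (0 < count (pred1 z) Y)%N by rewrite -has_count has_pred1.
lia.
Qed.

Lemma pos_lower_bound (R : realType) (s : seq R) : all (fun t => 0 < t) s ->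
  exists2 delta : R, 0 < delta & all (fun t => delta <= t) s.
Proof.
elim: s => [|t s IH] /= => [_|/andP[t0 /IH[e e0 es]]]; first by exists 1.
exists (Num.min t e); first by rewrite lt_min t0.
rewrite ge_min lexx /=; apply/allP => u /(allP es) eu.
by rewrite ge_min eu orbT.
Qed.

Lemma seq_separation (R : realType) (Y : seq R) :
  exists2 delta : R, 0 < delta &
    forall x y, x \in Y -> y \in Y -> x != y -> delta <= `|x - y|.
Proof.
have [|delta d0 /allP dP] :=
  @pos_lower_bound R [seq `|u.1 - u.2| | u <- [seq (x, y) | x <- Y, y <- Y] & u.1 != u.2].
  apply/allP => t /mapP[[x y]]; rewrite mem_filter /= => /andP[xy _] ->.
  by rewrite normr_gt0 subr_eq0.
exists delta => // x y xY yY xy; apply: dP; apply/mapP; exists (x, y) => //.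
by rewrite mem_filter xy allpairs_f.
Qed.

(** Targets are counted rather than servers, since several servers may share a target. *)
Definition covered (R : realType) (Y C : seq R) : nat := count (fun y => y \in C) Y.

(* Server [i] has been dragged off the target [w] immediately to its right
   (resp. left). *)
Definition right_hole (R : realType) (k : nat) (Y C : seq R) (i : nat) : Prop :=
  C`_i \notin Y /\ exists w, [/\ w \in Y, w \notin C, C`_i < w &
    (i.+1 < k)%N -> w < C`_i.+1].

Definition left_hole (R : realType) (Y C : seq R) (i : nat) : Prop :=
  C`_i \notin Y /\ exists w, [/\ w \in Y, w \notin C, w < C`_i &
    (0 < i)%N -> C`_i.-1 < w].

(** A server landing on [z] from another target has travelled at least [delta]. If it comes from
    elsewhere, [z] is gained, and only the second moving server can uncover a target. That loss is
    either a long move or a short one, which leaves a hole. *)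
Lemma dc_request (R : realType) (lam delta : R) (k : nat) (Y C C' : seq R) (z : R)
    (p : nat) :
  uniq Y -> (forall x y, x \in Y -> y \in Y -> x != y -> delta <= `|x - y|) ->
  (0 < k)%N -> config_ok k C -> z \in Y -> z \notin C -> dc_step lam k C z p C' ->
  [\/ delta <= move_cost C C', (covered Y C < covered Y C')%N |
    (covered Y C <= covered Y C')%N /\ exists i, [/\ (i.+1 < k)%N, C`_i < z < C`_i.+1 &
      C`_i.+1 \in Y /\ right_hole k Y C' i.+1 \/ C`_i \in Y /\ left_hole Y C' i]].
Proof.
move=> uY sep k0 Cok zY zC step; have [sC _] := Cok.
have [[sC' _] zC'] := dc_step_serves k0 Cok step.
have far x : x \in C -> x \in Y -> delta <= `|x - z|.
  by move=> xC xY; apply: sep => //; apply: contraNneq zC => <-.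
have cost_ge j : (j < k)%N -> `|C`_j - C'`_j| <= move_cost C C'.
  move=> jk; rewrite /move_cost sC (bigD1 (Ordinal jk)) //= lerDl.
  by apply: sumr_ge0.
have landed j : (j < k)%N -> C`_j \in Y -> C'`_j = z -> delta <= move_cost C C'.
  by move=> jk CjY C'j; apply: le_trans (cost_ge j jk); rewrite C'j far ?mem_nth ?sC.
have gain : (forall j, (j < k)%N -> C`_j \in Y -> C`_j \in C') -> (covered Y C < covered Y C')%N.
  move=> keep; apply: (count_gain _ zY) => // y yY /(nthP 0)[j jk yE].
  by rewrite -yE keep -?sC // yE.
have kept j : (j < k)%N -> C'`_j = C`_j -> C`_j \in C' by move=> jk <-; rewrite mem_nth ?sC'.
case: step => [zC0|r0 C'E|rk C'E|i a b ik LU C'E [a0 b0 La Ub] hit _].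
- by rewrite zC0 in zC.
- case: (boolP (C`_0 \in Y)) => C0Y.
    by apply: Or31; apply: (landed 0%N) => //; rewrite C'E nth_set_nth.
  apply: Or32; apply: gain => -[|j] jk jY; first by rewrite jY in C0Y.
  by apply: kept => //; rewrite C'E nth_set_nth.
- have k1 : (k.-1 < k)%N by rewrite prednK.
  case: (boolP (C`_k.-1 \in Y)) => CkY.
    by apply: Or31; apply: (landed k.-1) => //; rewrite C'E nth_set_nth /= eqxx.
  apply: Or32; apply: gain => j jk jY; apply: kept => //; rewrite C'E nth_set_nth /=.
  by case: eqP => // jE; rewrite -jE jY in CkY.
have ik' := ltnW ik.
have C'i : C'`_i = C`_i + a by rewrite C'E nth_set_nth /= ltn_eqF // nth_set_nth /= eqxx.
have C'i1 : C'`_i.+1 = C`_i.+1 - b by rewrite C'E nth_set_nth /= eqxx.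
have C'j j : j != i -> j != i.+1 -> C'`_j = C`_j.
  by move=> ji ji1; rewrite C'E !nth_set_nth /= (negbTE ji1) nth_set_nth /= (negbTE ji).
have gain2 : (C`_i \in Y -> C`_i \in C') -> (C`_i.+1 \in Y -> C`_i.+1 \in C') ->
    (covered Y C < covered Y C')%N.
  move=> hi hi1; apply: gain => j jk jY.
  case: (eqVneq j i) jY => [-> /hi //|ji]; case: (eqVneq j i.+1) => [-> /hi1 //|ji1] _.
  by apply: kept => //; apply: C'j.
(* A nonzero displacement shorter than [delta] ends off [Y]. *)
have near x t : x \in Y -> 0 < `|t| -> `|t| < delta -> x + t \notin Y.
  move=> xY t0 td; apply/negP => xtY.
  have /(sep _ _ xtY xY) : x + t != x by rewrite -subr_eq0 addrC addKr -normr_gt0.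
  by rewrite addrC addKr leNgt td.
have exchange w : (forall j, (j < k)%N -> C`_j \in Y -> C`_j \in C' \/ C`_j = w) ->
    (covered Y C <= covered Y C')%N.
  move=> keep; apply: (count_exchange (w := w) uY _ zY) => // y yY /(nthP 0)[j jk yE].
  by rewrite -yE; apply: keep; rewrite -?sC // yE.
case: hit => hit.
- case: (boolP (C`_i \in Y)) => CiY; first by apply: Or31; apply: (landed i); rewrite // C'i.
  case: (boolP (C`_i.+1 \in Y)) => Ci1Y; last by apply: Or32; apply: gain2 => // Y1;
    [rewrite Y1 in CiY | rewrite Y1 in Ci1Y].
  (* Another server may still stand on the target that is left; then nothing is lost. *)
  case: (boolP (C`_i.+1 \in C')) => Ci1C'; first by apply: Or32; apply: gain2 => // Y1; rewrite Y1 in CiY.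
  have b_gt0 : 0 < b.
    rewrite lt0r b0 andbT; apply: contraNneq Ci1C' => b00.
    by apply: kept => //; rewrite C'i1 b00 subr0.
  case: (leP delta b) => [db|bd].
    by apply: Or31; apply: le_trans (cost_ge _ ik); rewrite C'i1 opprB addrC subrK ger0_norm.
  apply: Or33; split.
    apply: (exchange C`_i.+1) => j jk jY.
    case: (eqVneq j i) jY => [-> Y1|ji _]; first by rewrite Y1 in CiY.
    case: (eqVneq j i.+1) => [->|ji1]; [by right | left].
    by apply: kept => //; apply: C'j.
  exists i; split=> //; left; split=> //; split.
    by rewrite C'i1; apply: near => //; rewrite normrN gtr0_norm.
  exists C`_i.+1; split=> //; first by rewrite C'i1; lra.
  move=> ik2; rewrite lt_neqAle C'j ?gtn_eqF // (config_le Cok) // andbT.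
  by apply: contra Ci1C' => /eqP ->; apply: kept => //; rewrite C'j ?gtn_eqF.
- case: (boolP (C`_i.+1 \in Y)) => Ci1Y; first by apply: Or31; apply: (landed i.+1); rewrite // C'i1.
  case: (boolP (C`_i \in Y)) => CiY; last by apply: Or32; apply: gain2 => // Y1;
    [rewrite Y1 in CiY | rewrite Y1 in Ci1Y].
  case: (boolP (C`_i \in C')) => CiC'; first by apply: Or32; apply: gain2 => // Y1; rewrite Y1 in Ci1Y.
  have a_gt0 : 0 < a.
    rewrite lt0r a0 andbT; apply: contraNneq CiC' => a00.
    by apply: kept => //; rewrite C'i a00 addr0.
  case: (leP delta a) => [da|ad].
    by apply: Or31; apply: le_trans (cost_ge _ ik'); rewrite C'i opprD addNKr normrN ger0_norm.
  apply: Or33; split.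
    apply: (exchange C`_i) => j jk jY.
    case: (eqVneq j i.+1) jY => [-> Y1|ji1 _]; first by rewrite Y1 in Ci1Y.
    case: (eqVneq j i) => [->|ji]; [by right | left].
    by apply: kept => //; apply: C'j.
  exists i; split=> //; right; split=> //; split.
    by rewrite C'i; apply: near => //; rewrite gtr0_norm.
  exists C`_i; split=> //; first by rewrite C'i; lra.
  case: i {LU C'E hit La Ub} => // i in ik ik' C'i C'i1 C'j gain2 Ci1Y CiY CiC' * => _ /=.
  rewrite lt_neqAle C'j ?ltn_eqF // (config_le Cok) // andbT.
  apply: contra CiC' => /eqP <-; apply: kept => //; first exact: ltnW.
  by rewrite C'j ?ltn_eqF.
Qed.

(** * Request sequences and progress towards the targets *)

Definition reaches (R : realType) (k : nat) (A : mc_alg R k) (Y C C' : seq R) : Prop :=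
  exists (rs : seq R) (ps : seq 'I_k),
    size ps = size rs /\ all (fun r => r \in Y) rs /\ alg_final A C rs ps = C'.

Lemma reaches_refl (R : realType) (k : nat) (A : mc_alg R k) (Y C : seq R) :
  reaches A Y C C.
Proof. by exists [::], [::]. Qed.

Lemma reaches_trans (R : realType) (k : nat) (A : mc_alg R k) (Y C1 C2 C3 : seq R) :
  reaches A Y C1 C2 -> reaches A Y C2 C3 -> reaches A Y C1 C3.
Proof.
move=> [rs [ps [sz [rsY <-]]]] [rs' [ps' [sz' [rsY' <-]]]].
exists (rs ++ rs'), (ps ++ ps'); rewrite !size_cat sz sz' all_cat rsY rsY'; split=> //; split=> //.
by elim: rs ps C1 sz {rsY} => [|r rs IH] [|p ps] C1 //= [/IH].
Qed.

(** A lexicographic decrease: the potential falls by [delta], or it does not grow and one more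
    target is covered. *)
Definition progress (R : realType) (k : nat) (lam delta al : R) (d : nat -> R)
    (Y C : seq R) : Prop :=
  exists C', [/\ reaches (lambda_dc lam (k := k)) Y C C', config_ok k C' &
    ftp_potential k al d C' Y <= ftp_potential k al d C Y - delta \/
    ftp_potential k al d C' Y <= ftp_potential k al d C Y /\ (covered Y C < covered Y C')%N].

(* Predicting [j] for a request at the target [Y_j] makes FtP, started at [Y],
   free, so the FtP potential pays for the whole move. *)
Lemma request_target (R : realType) (k : nat) (lam delta al : R) (d : nat -> R)
    (Y C : seq R) (z : R) :
  0 <= lam <= 1 -> 0 <= al -> ftp_weights k lam al d -> (0 < k)%N ->
  config_ok k Y -> uniq Y ->
  (forall x y, x \in Y -> y \in Y -> x != y -> delta <= `|x - y|) ->
  config_ok k C -> z \in Y -> z \notin C ->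
  progress k lam delta al d Y C \/
  exists C', [/\ reaches (lambda_dc lam (k := k)) Y C C', config_ok k C',
    ftp_potential k al d C' Y <= ftp_potential k al d C Y,
    (covered Y C <= covered Y C')%N &
    exists i, [/\ (i.+1 < k)%N, C`_i < z < C`_i.+1 &
      C`_i.+1 \in Y /\ right_hole k Y C' i.+1 \/ C`_i \in Y /\ left_hole Y C' i]].
Proof.
move=> lam01 al0 dW k0 [sY Y_sorted] uY sep Cok zY zC.
have [j jk Yj] := nthP 0 zY; rewrite sY in jk.
have step := lambda_dcP z (Ordinal jk) lam01 Cok; set C' := lambda_dc _ _ _ _ in step.
have [C'ok _] := dc_step_serves k0 Cok step.
have reach1 : reaches (lambda_dc lam (k := k)) Y C C'.
  by exists [:: z], [:: Ordinal jk]; rewrite /= zY.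
have setY : sort <=%R (set_nth 0 Y j z) = Y.
  suff -> : set_nth 0 Y j z = Y by apply: sort_le_id.
  apply: (@eq_from_nth _ 0) => [|i _]; first by rewrite sY; apply: size_set_nth_in.
  by rewrite nth_set_nth /=; case: eqP => // ->.
have := ftp_potential_step al0 dW Cok sY jk step.
rewrite setY Yj subrr normr0 mulr0 addr0 => drop.
have cost0 := move_cost_ge0 C C'.
have [cost|gain|[keep hole]] := dc_request uY sep k0 Cok zY zC step.
- by left; exists C'; split=> //; left; lra.
- by left; exists C'; split=> //; right; split=> //; lra.
- by right; exists C'; split=> //; lra.
Qed.

Lemma progress_trans (R : realType) (k : nat) (lam delta al : R) (d : nat -> R)
    (Y C C' : seq R) :
  reaches (lambda_dc lam (k := k)) Y C C' ->
  ftp_potential k al d C' Y <= ftp_potential k al d C Y ->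
  (covered Y C <= covered Y C')%N ->
  progress k lam delta al d Y C' -> progress k lam delta al d Y C.
Proof.
move=> CC' pot cov [C2 [C'C2 C2ok gain]]; exists C2; split=> //.
  exact: reaches_trans C'C2.
case: gain => [gain|[gain1 gain2]]; [left; lra | right; split; [lra|]].
exact: leq_ltn_trans gain2.
Qed.

Lemma gap_index_uniq (R : realType) (k : nat) (C : seq R) (z : R) (i j : nat) :
  config_ok k C -> (i < k)%N -> (j < k)%N ->
  C`_i < z -> ((i.+1 < k)%N -> z < C`_i.+1) ->
  C`_j < z -> ((j.+1 < k)%N -> z < C`_j.+1) -> i = j.
Proof.
move=> Cok; wlog ij : i j / (i <= j)%N.
  move=> W ik jk; have [ij|/ltnW ji] := leqP i j; first exact: W.
  by move=> *; symmetry; apply: W.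
move=> ik jk Ci Ci1 Cj Cj1; apply/eqP; rewrite eqn_leq ij leqNgt; apply/negP => lt_ij.
have := Ci1 (leq_ltn_trans lt_ij jk); have := config_le Cok lt_ij jk; lra.
Qed.

(** Request the abandoned target [w]. If no progress results, a hole appears in the same gap; as
    server [i] is off [Y], it can only be a right hole at [i + 1]. The last server has no gap to its
    right, so this stops. *)
Lemma right_hole_progress (R : realType) (k : nat) (lam delta al : R) (d : nat -> R)
    (Y C : seq R) (i : nat) :
  0 <= lam <= 1 -> 0 <= al -> ftp_weights k lam al d ->
  config_ok k Y -> uniq Y ->
  (forall x y, x \in Y -> y \in Y -> x != y -> delta <= `|x - y|) ->
  config_ok k C -> (i < k)%N -> right_hole k Y C i -> progress k lam delta al d Y C.
Proof.
move=> lam01 al0 dW Yok uY sep.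
have [n] := ubnP (k - i); elim: n i C => // n IH i C ni Cok ik [CiY [w [wY wC Ci Ci1]]].
have k0 : (0 < k)%N by apply: leq_ltn_trans ik.
have [//|[C' [CC' C'ok pot cov [j [jk /andP[Cj Cj1] hole]]]]] :=
  request_target lam01 al0 dW k0 Yok uY sep Cok wY wC.
have ij : i = j by apply: gap_index_uniq Ci Ci1 Cj _ => //; apply: ltnW.
case: hole => [[_ hole]|[CjY _]]; last by rewrite ij CjY in CiY.
apply: progress_trans CC' pot cov _; apply: IH jk hole => //.
by rewrite -ij subnS prednK ?subn_gt0.
Qed.

(** Mirror image: the hole passes from [i] to [i - 1], and left of the first server no gap
    remains. *)
Lemma left_hole_progress (R : realType) (k : nat) (lam delta al : R) (d : nat -> R)
    (Y C : seq R) (i : nat) :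
  0 <= lam <= 1 -> 0 <= al -> ftp_weights k lam al d ->
  config_ok k Y -> uniq Y ->
  (forall x y, x \in Y -> y \in Y -> x != y -> delta <= `|x - y|) ->
  config_ok k C -> (i < k)%N -> left_hole Y C i -> progress k lam delta al d Y C.
Proof.
move=> lam01 al0 dW Yok uY sep.
elim: i C => [|i IH] C Cok ik [CiY [w [wY wC Ci Ci1]]].
all: have k0 : (0 < k)%N by apply: leq_ltn_trans ik.
all: have [//|[C' [CC' C'ok pot cov [j [jk /andP[Cj Cj1] hole]]]]] :=
  request_target lam01 al0 dW k0 Yok uY sep Cok wY wC.
- by have := config_le Cok (leq0n j) (ltnW jk); lra.
have ij : i = j.
  exact: (gap_index_uniq Cok (ltnW ik) (ltnW jk) (Ci1 isT) (fun=> Ci) Cj (fun=> Cj1)).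
case: hole => [[CjY _]|[_ hole]]; first by rewrite ij CjY in CiY.
apply: progress_trans CC' pot cov _; apply: IH => //; first exact: ltnW.
by rewrite ij.
Qed.

Lemma covered_all (R : realType) (k : nat) (Y C : seq R) :
  config_ok k Y -> uniq Y -> config_ok k C -> {subset Y <= C} -> C = Y.
Proof.
move=> [sY Y_sorted] uY [sC C_sorted] YC.
have sz : (size C <= size Y)%N by rewrite sY sC.
have [sE YCi] := uniq_min_size uY YC sz.
apply: (sorted_eq le_trans le_anti C_sorted Y_sorted).
by apply: uniq_perm => //; rewrite (eq_uniq sE) in uY.
Qed.

Lemma lambda_dc_erasable (R : realType) (k : nat) (lam : R) :
  (0 < k)%N -> 0 <= lam <= 1 -> erasable (lambda_dc lam (k := k)).
Proof.
move=> k0 lam01 X sX uX C Cok; have /andP[lam0 lam1] := lam01.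
set Y := sort <=%R X.
have Yok : config_ok k Y by split; rewrite ?size_sort ?sort_le_sorted.
have uY : uniq Y by rewrite sort_uniq.
have [delta delta0 sep] := seq_separation Y.
have [d [dW _ _]] := ftp_weights_exist lam01 k0.
set al := alpha_k lam k in dW.
have al0 : 0 <= al by apply: le_trans ler01 (alpha_k_ge1 lam0 k0).
pose pot C := ftp_potential k al d C Y.
suff [rs [ps [sz [rsY fin]]]] : reaches (lambda_dc lam (k := k)) Y C Y.
  by exists rs, ps; split=> //; split=> //; apply: sub_all rsY => r; rewrite mem_sort.
(* The nonnegative potential admits only finitely many drops by [delta]. *)
have [N] : exists N : nat, pot C < N%:R * delta.
  exists (Num.bound (pot C / delta)); rewrite -ltr_pdivrMr //.
  apply: archi_boundP; apply: divr_ge0; last exact: ltW.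
  exact: ftp_potential_ge0 al0 dW Cok.
have step C1 : config_ok k C1 -> ~ {subset Y <= C1} -> progress k lam delta al d Y C1.
  move=> C1ok /(introN allP)/allPn[z zY zC].
  have [//|[C' [CC' C'ok dpot cov [i [ik _ hole]]]]] :=
    request_target lam01 al0 dW k0 Yok uY sep C1ok zY zC.
  apply: progress_trans CC' dpot cov _; case: hole => -[_ hole].
  - exact: right_hole_progress hole.
  - by apply: left_hole_progress hole => //; apply: ltnW.
(* The outer induction counts drops of the potential, the inner one the targets still uncovered. *)
elim: N C Cok => [|N IHN] C Cok.
  by rewrite mul0r ltNge (ftp_potential_ge0 _ al0 dW).
have [n] := ubnP (k - covered Y C); elim: n C Cok => // n IHn C Cok nC potC.
have [/allP YC|/allP YC] := boolP (all (fun y => y \in C) Y).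
  by rewrite (covered_all Yok uY Cok YC); exact: reaches_refl.
have [C' [CC' C'ok gain]] := step C Cok YC.
apply: reaches_trans CC' _; case: gain => [drop|[le_pot cov]].
- by apply: IHN => //; move: potC; rewrite /pot -natr1 mulrDl; lra.
- apply: IHn => //; last exact: le_lt_trans potC.
  have : (covered Y C' <= k)%N by rewrite -(proj1 Yok) count_size.
  by move: nC cov; lia.
Qed.

(** * Combining the consistency and robustness bounds *)

Theorem theorem1 (R : realType) (k : nat) (lam : R) :
  (1 <= k)%N -> 0 <= lam <= 1 ->
  exists A : mc_alg R k,
    memory_constrained A /\
    forall C0 : seq R, config_ok k C0 ->
      exists c : R, 0 <= c /\
        forall (rs : seq R) (ps : seq 'I_k), size ps = size rs ->
          alg_cost A C0 rs ps
            <= perf_bound lam k (OPT k C0 rs) (pred_error C0 rs ps) + c.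
Proof.
move=> k0 lam01; exists (lambda_dc lam (k := k)); split.
  split; last exact: lambda_dc_erasable.
  by move=> C r p Cok; exact: dc_step_serves (lambda_dcP r p lam01 Cok).
have /andP[lam_ge0 lam_le1] := lam01.
move=> C0 C0ok; have [d [dW _ _]] := ftp_weights_exist lam01 k0.
have al0 : 0 <= alpha_k lam k by apply: le_trans ler01 (alpha_k_ge1 lam_ge0 k0).
pose c1 := ftp_potential k (alpha_k lam k) d C0 C0.
have c1_ge0 : 0 <= c1 by exact: ftp_potential_ge0 al0 dW C0ok.
(* By definition of the error, [OPT] plus [eta] is the cost of FtP. *)
have ftp_bound rs (ps : seq 'I_k) : alg_cost (lambda_dc lam (k := k)) C0 rs ps <=
    alpha_k lam k * (OPT k C0 rs + pred_error C0 rs ps) + c1.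
  by rewrite /pred_error (addrC (OPT _ _ _)) subrK; apply: alg_cost_le_ftp => //; case: C0ok.
rewrite /perf_bound; have [lam_gt0|_] := ltP 0 lam; last first.
  by exists c1; split=> // rs ps _; exact: ftp_bound.
have lam01' : 0 < lam <= 1 by rewrite lam_gt0.
pose c2 := opt_potential lam k C0 C0.
have c2_ge0 : 0 <= c2 by exact: opt_potential_ge0.
(* Both initial potentials are nonnegative and depend only on [C0], so their sum serves both terms
   of the minimum. *)
exists (c1 + c2); split=> [|rs ps _]; first exact: addr_ge0.
have := ftp_bound rs ps; have := alg_cost_le_OPT rs ps lam01' k0 C0ok.
by rewrite -/c2 => ? ?; rewrite -lerBlDr le_min; apply/andP; split; lra.
Qed.
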